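(* Consider a node $J$ with one incoming arc (index $1$) and one outgoing arc (index $2$), with flux $f$. A Riemann solver $\mathcal{RS}$ at $J$ satisfies the entropy inequality $\mathrm{sgn}(\bar\rho_1-k)(f(\bar\rho_1)-f(k))-\mathrm{sgn}(\bar\rho_2-k)(f(\bar\rho_2)-f(k))\ge0$ for every initial datum $(\rho_{1,0},\rho_{2,0})\in[0,1]^2$ and every $k\in[0,1]$, where $(\bar\rho_1,\bar\rho_2)=\mathcal{RS}(\rho_{1,0},\rho_{2,0})$, if and only if, for every initial datum $(\rho_{1,0},\rho_{2,0})\in[0,1]^2$, the image $(\bar\rho_1,\bar\rho_2)=\mathcal{RS}(\rho_{1,0},\rho_{2,0})$ satisfies either $\bar\rho_1=\bar\rho_2$, or $\bar\rho_1<\bar\rho_2$ and $f(\bar\rho_1)=f(\bar\rho_2)$.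
   Context: Flux: $f:[0,1]\to\mathbb R$ is a continuous, piecewise smooth, concave function with $f(0)=f(1)=0$, and there is a unique $\sigma\in\,]0,1[$ such that $f$ is strictly increasing on $[0,\sigma[$ and strictly decreasing on $]\sigma,1]$. Let $\tau:[0,1]\to[0,1]$ be the map with $f(\tau(\rho))=f(\rho)$ for all $\rho\in[0,1]$ and $\tau(\rho)\neq\rho$ for all $\rho\ne\sigma$. Convention: $\mathrm{sgn}(0)=0$. Riemann solver (one incoming, one outgoing arc): a function $\mathcal{RS}:[0,1]^2\to[0,1]^2$, $(\rho_{1,0},\rho_{2,0})\mapsto(\bar\rho_1,\bar\rho_2)$, such that for every initial datum: (1) $f(\bar\rho_1)=f(\bar\rho_2)$; (2) the classical Riemann problem for $\rho_t+f(\rho)_x=0$ with left state $\rho_{1,0}$ and right state $\bar\rho_1$ is solved with waves with negative speed; that is, $\bar\rho_1\in\{\rho_{1,0}\}\cup\,]\tau(\rho_{1,0}),1]$ if $\rho_{1,0}\le\sigma$ and $\bar\rho_1\in[\sigma,1]$ if $\rho_{1,0}\ge\sigma$; (3) the classical Riemann problem with left state $\bar\rho_2$ and right state $\rho_{2,0}$ is solved with waves with positive speed; that is, $\bar\rho_2\in[0,\sigma]$ if $\rho_{2,0}\le\sigma$ and $\bar\rho_2\in\{\rho_{2,0}\}\cup[0,\tau(\rho_{2,0})[$ if $\rho_{2,0}\ge\sigma$. (E1): $\mathcal{RS}$ satisfies (E1) if for every initial datum and every $k\in[0,1]$, with $(\bar\rho_1,\bar\rho_2)=\mathcal{RS}(\rho_{1,0},\rho_{2,0})$,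 one has $\mathrm{sgn}(\bar\rho_1-k)(f(\bar\rho_1)-f(k))-\mathrm{sgn}(\bar\rho_2-k)(f(\bar\rho_2)-f(k))\ge0$. *)

(* Defs.v *)
From HB Require Import structures.
From mathcomp Require Import all_boot all_order all_algebra.
From mathcomp Require Import all_classical all_reals all_analysis.
Set Implicit Arguments.
Unset Strict Implicit.
Unset Printing Implicit Defensive.
Import Order.TTheory GRing.Theory Num.Theory.
Import numFieldNormedType.Exports.
Local Open Scope classical_set_scope.
Local Open Scope ring_scope.

(* Only the values of a flux, of [tau] and of a Riemann solver on [0, 1] are
   ever constrained or used: functions on [0, 1] are total functions on [R]
   whose values elsewhere are irrelevant. *)

Definition smooth_on (R : realType) (a b : R) (g : R -> R) : Prop :=
  forall (n : nat) (x : R), x \in `]a, b[ -> derivable (derive1n n g) x 1.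

(* Smoothness is required inside the pieces only; one-sided derivatives at
   the break points need not exist. *)
Definition piecewise_smooth (R : realType) (a b : R) (g : R -> R) : Prop :=
  exists2 s : seq R, itv_partition a b s &
    forall i, (i < size s)%N -> smooth_on (nth b (a :: s) i) (nth b s i) g.

Definition concave_function (R : realType) (D : set R) (g : R -> R) : Prop :=
  convex_function (D : set R^o) (fun x : R^o => - g x).

Definition is_peak (R : realType) (f : R -> R) (sigma : R) : Prop :=
  [/\ sigma \in `]0, 1[,
      {in `[0, sigma[ &, {homo f : x y / x < y >-> x < y}} &
      {in `]sigma, 1] &, {homo f : x y / x < y >-> y < x}}].

Record is_flux (R : realType) (f : R -> R) (sigma : R) : Prop := IsFlux {
  flux_continuous : {within `[0, 1], continuous f};
  flux_piecewise_smooth : piecewise_smooth 0 1 f;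
  flux_concave : concave_function `[0, 1] f;
  flux0 : f 0 = 0;
  flux1 : f 1 = 0;
  flux_peak : unique (is_peak f) sigma
}.

Definition is_flux_conjugate (R : realType) (f : R -> R) (sigma : R)
    (tau : R -> R) : Prop :=
  [/\ {in `[0, 1], forall rho, tau rho \in `[0, 1]},
      {in `[0, 1], forall rho, f (tau rho) = f rho} &
      {in `[0, 1], forall rho, rho != sigma -> tau rho != rho}].

(* The traces [r1] such that the Riemann problem with left state [r10] and
   right state [r1] is solved with waves of negative speed. *)
Definition incoming_trace (R : realType) (sigma : R) (tau : R -> R)
    (r10 r1 : R) : Prop :=
  (r10 <= sigma -> r1 = r10 \/ r1 \in `]tau r10, 1]) /\
  (sigma <= r10 -> r1 \in `[sigma, 1]).

(* The traces [r2] such that the Riemann problem with left state [r2] and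
   right state [r20] is solved with waves of positive speed. *)
Definition outgoing_trace (R : realType) (sigma : R) (tau : R -> R)
    (r20 r2 : R) : Prop :=
  (r20 <= sigma -> r2 \in `[0, sigma]) /\
  (sigma <= r20 -> r2 = r20 \/ r2 \in `[0, tau r20[).

Definition is_riemann_solver (R : realType) (f : R -> R) (sigma : R)
    (tau : R -> R) (RS : R * R -> R * R) : Prop :=
  forall r10 r20 r1 r2 : R, r10 \in `[0, 1] -> r20 \in `[0, 1] ->
    RS (r10, r20) = (r1, r2) ->
    [/\ r1 \in `[0, 1] /\ r2 \in `[0, 1], f r1 = f r2,
        incoming_trace sigma tau r10 r1 &
        outgoing_trace sigma tau r20 r2].

Definition entropy_E1 (R : realType) (f : R -> R) (RS : R * R -> R * R) :
    Prop :=
  forall r10 r20 r1 r2 k : R, r10 \in `[0, 1] -> r20 \in `[0, 1] ->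
    k \in `[0, 1] -> RS (r10, r20) = (r1, r2) ->
    0 <= Num.sg (r1 - k) * (f r1 - f k) - Num.sg (r2 - k) * (f r2 - f k).

(* Main.v *)
Require Import Defs.
From mathcomp Require Import all_boot all_order all_algebra.
From mathcomp Require Import all_classical all_reals all_analysis.
From mathcomp Require Import lra.
Import Order.TTheory GRing.Theory Num.Theory.
Import numFieldNormedType.Exports.
Local Open Scope classical_set_scope.
Local Open Scope ring_scope.

(** Both traces [r1] and [r2] of a Riemann solver carry the same flux value [c],
by conservation at the node.  The entropy expression at level [k] is therefore
[(sg (r1 - k) - sg (r2 - k)) * (c - f k)]: it vanishes as soon as [k] is on the
same side of both traces, or equal to one of them, and in between it equals
[2 * (c - f k)] if [r2 < k < r1] and [2 * (f k - c)] if [r1 < k < r2].  The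
entropy condition is thus a comparison of [f] with the common value [c] between
the two traces, and the shape of the flux decides it.

If [r1 < r2], the graph of the concave function [f] lies above its horizontal
chord, so that [f k >= c] for every [k] in between and the inequality holds
([concave_ge_min]).

If [r2 < r1], the inequality asks that [f k <= c] for every [k] in between.
This fails at some [k], because [f] is strictly monotone on each side of its
peak and hence exceeds the smaller of its two end values somewhere inside any
nondegenerate interval ([peak_gt_min]). *)

Lemma concave_ge_min (R : realType) (D : set R) (f : R -> R) (x y k : R) :
  concave_function D f -> x \in D -> y \in D -> x <= k <= y ->
  Num.min (f x) (f y) <= f k.
Proof.
move=> concf xD yD /andP[xk ky].
have [xy|yx] := ltP x y; last first.
  have -> : k = x by apply/eqP; rewrite eq_le xk (le_trans ky yx).
  by rewrite ge_min lexx.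
have : [set` `[x, y]] k by rewrite /= in_itv/= xk.
(* The point [k] is the barycenter of [y] and [x] with weights [t], [1 - t]. *)
rewrite -(range_line_path true false xy) => -[t]; rewrite /= in_itv/=.
move=> /andP[t0 t1] <-.
have : - f (t * y + (1 - t) * x) <= t * - f y + (1 - t) * - f x.
  exact: concf (Itv01 t0 t1) y x yD xD.
rewrite [_ * y + _]addrC -/(line_path x y t); set fk := f _.
(* The chord only decreases when both end values are replaced by their minimum,
   and then it is constant. *)
have [mx my] : Num.min (f x) (f y) <= f x /\ Num.min (f x) (f y) <= f y.
  by rewrite !ge_min !lexx orbT.
by move: (Num.min _ _) mx my => m mx my chord; nra.
Qed.

(** If the interval starts before the peak, [f] exceeds [f x] just to the right
of [x]; otherwise the whole interior of the interval lies on the decreasing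
side and [f] exceeds [f y] there. *)
Lemma peak_gt_min (R : realType) (f : R -> R) (sigma x y : R) :
  is_peak f sigma -> 0 <= x -> x < y -> y <= 1 ->
  exists2 k, x < k < y & Num.min (f x) (f y) < f k.
Proof.
move=> [_ incr decr] x0 xy y1.
have [xs|sx] := ltP x sigma.
  (* [k] must stay below [sigma], where the increasing side stops. *)
  have xm : x < Num.min sigma y by rewrite lt_min xs xy.
  have [] := midf_lt xm; set k := (_ + _) / _ => xk.
  rewrite lt_min => /andP[ks ky]; exists k; first by rewrite xk ky.
  by rewrite gt_min incr // !in_itv/=; apply/andP; split; lra.
have [] := midf_lt xy; set k := (_ + _) / _ => xk ky.
exists k; first by rewrite xk ky.
by rewrite gt_min [f y < _]decr ?orbT// !in_itv/=; apply/andP; split; lra.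
Qed.

Lemma entropy_decreasing_jump (R : realType) (f : R -> R) (r1 r2 k : R) :
  f r1 = f r2 -> r2 < k < r1 ->
  Num.sg (r1 - k) * (f r1 - f k) - Num.sg (r2 - k) * (f r2 - f k)
    = (f r1 - f k) *+ 2.
Proof.
move=> <- /andP[r2k kr1].
by rewrite gtr0_sg ?subr_gt0// ltr0_sg ?subr_lt0// mul1r mulN1r opprK.
Qed.

(** Only the levels strictly between the traces carry information: outside,
the two signs agree, and at a trace the flux difference is zero by
conservation. *)
Lemma entropy_increasing_jump (R : realType) (f : R -> R) (r1 r2 k : R) :
  f r1 = f r2 -> r1 < r2 -> (r1 < k < r2 -> f r1 <= f k) ->
  0 <= Num.sg (r1 - k) * (f r1 - f k) - Num.sg (r2 - k) * (f r2 - f k).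
Proof.
move=> fr r12 ck; rewrite -fr -mulrBl.
have [r1k|kr1|->] := ltgtP r1 k; last by rewrite [f k - _]subrr mulr0.
- have [kr2|r2k|->] := ltgtP k r2; last by rewrite fr [f r2 - _]subrr mulr0.
  + have {}ck : f r1 <= f k by apply: ck; rewrite r1k.
    by rewrite ltr0_sg ?subr_lt0// gtr0_sg ?subr_gt0//; lra.
  + by rewrite !ltr0_sg ?subr_lt0// subrr mul0r.
- have kr2 := lt_trans kr1 r12.
  by rewrite !gtr0_sg ?subr_gt0// subrr mul0r.
Qed.

Theorem proposition4p1 (R : realType) (f : R -> R) (sigma : R) (tau : R -> R)
    (RS : R * R -> R * R)
    (Hf : is_flux f sigma)
    (Htau : is_flux_conjugate f sigma tau)
    (HRS : is_riemann_solver f sigma tau RS) :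
  entropy_E1 f RS <->
  (forall r10 r20 r1 r2 : R, r10 \in `[0, 1] -> r20 \in `[0, 1] ->
     RS (r10, r20) = (r1, r2) ->
     r1 = r2 \/ (r1 < r2 /\ f r1 = f r2)).
Proof.
split=> [E1 r10 r20 r1 r2 h1 h2 eRS|ordered r10 r20 r1 r2 k h1 h2 _ eRS];
  have [[r1I r2I] fr _ _] := HRS _ _ _ _ h1 h2 eRS.
- have [r12|r21|] := ltgtP r1 r2; [by right | exfalso | by left].
  have [r2_0 r1_1] : 0 <= r2 /\ r1 <= 1.
    by move: r1I r2I; rewrite !in_itv/= => /andP[_ ->] /andP[-> _].
  have [peakf _] := flux_peak Hf.
  have [k /andP[r2k kr1]] := peak_gt_min _ _ _ _ _ peakf r2_0 r21 r1_1.
  rewrite -fr minxx => fk.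
  have kI : k \in `[0, 1] by rewrite in_itv/=; apply/andP; split; lra.
  have := E1 _ _ _ _ k h1 h2 kI eRS.
  by rewrite entropy_decreasing_jump ?r2k// pmulrn_lge0// subr_ge0 leNgt fk.
- have [->|[r12 _]] := ordered _ _ _ _ h1 h2 eRS; first by rewrite subrr.
  apply: entropy_increasing_jump => // /andP[r1k kr2].
  have := concave_ge_min _ _ _ r1 r2 k (flux_concave Hf).
  rewrite -fr minxx !inE; apply=> //; by rewrite !ltW.
Qed.
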